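(* Let $m$ be a positive integer, let $\mathcal{X}_1,\dots,\mathcal{X}_m$ be sets such that $\mathcal{X}^m:=\mathcal{X}_1\times\dots\times\mathcal{X}_m$ is finite, and let $\mathcal{Y}$ be a measurable space. Fix a random transformation (Markov kernel) $Q_{Y|X^m}$ from $\mathcal{X}^m$ to $\mathcal{Y}$, probability measures $Q_{X_j}$ on $\mathcal{X}_j$ and constants $c_j\in(0,\infty)$ for $j=1,\dots,m$, a probability measure $R_Y$ on $\mathcal{Y}$, and $d\in\mathbb{R}$. Let $Q_Y$ be the output distribution of $Q_{Y|X^m}$ when the input distribution is $\prod_jQ_{X_j}$, and assume $Q_Y\ll R_Y$. Then the following two statements are equivalent: 1) For any functions $f_j\colon\mathcal{X}_j\to[0,+\infty)$, $j=1,\dots,m$, if $F\colon\mathcal{Y}\to[0,+\infty)$ is a measurable function such that $$\mathbb{E}[\log F(Y)\,|\,X^m=x^m]\ \ge\ \sum_{j=1}^m c_j\log f_j(x_j)\qquad\text{for }\textstyle\prod_jQ_{X_j}\text{-almost every }x^m,$$ then $$\int F\,\mathrm{d}R_Y\ \ge\ \exp(d)\prod_{j=1}^m\left(\int f_j\,\mathrm{d}Q_{X_j}\right)^{c_j}.$$ 2) For any probability measures $P_{X_j}$ on $\mathcal{X}_j$, $j=1,\dots,m$, there exists a coupling $P_{X^m}$ of $(P_{X_j})_{j=1}^m$ such that $$D(P_Y\|R_Y)+d\ \le\ \sum_{j=1}^m c_j\,D(P_{X_j}\|Q_{X_j}),$$ where $P_Y$ is the output distribution of $Q_{Y|X^m}$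 when the input distribution is $P_{X^m}$.
   Context: A coupling of $(P_{X_j})$ is a probability measure on $\mathcal{X}^m$ whose $j$-th marginal is $P_{X_j}$ for every $j$. The output distribution for input $P_{X^m}$ is $P_Y(B)=\sum_{x^m}Q_{Y|X^m}(B|x^m)P_{X^m}(x^m)$. $\mathbb{E}[\log F(Y)|X^m=x^m]=\int\log F\,\mathrm{d}Q_{Y|X^m=x^m}$; $\log0=-\infty$, and the hypothesis on $F$ in 1) includes that this integral is well defined in $[-\infty,\infty]$ for almost every $x^m$. For probability measures $P,Q$ on the same space, $D(P\|Q):=\mathbb{E}_P\left[\log\frac{\mathrm{d}P}{\mathrm{d}Q}\right]$ if $P\ll Q$, and $+\infty$ otherwise. *)

(* Defs.v *)
From HB Require Import structures.
From mathcomp Require Export all_boot all_order all_algebra.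
From mathcomp Require Export all_classical all_reals all_analysis.

Set Implicit Arguments.
Unset Strict Implicit.
Unset Printing Implicit Defensive.

Import Order.TTheory GRing.Theory Num.Theory.
Import numFieldNormedType.Exports.

Local Open Scope classical_set_scope.
Local Open Scope ring_scope.
Local Open Scope ereal_scope.

(* The library's measurable types are pointed, so a finite alphabet has to be
   pointed too; this only excludes the empty alphabet, which carries no
   probability measure. *)
#[short(type="finPointedType")]
HB.structure Definition FinPointed := {T of isPointed T & Finite T}.

Section discr.
Variable T : finPointedType.

(* An alias carrying the discrete sigma-algebra. *)
Definition discr : Type := T.

HB.instance Definition _ := FinPointed.on discr.
HB.instance Definition _ := @isMeasurable.Build default_measure_display
  discr discrete_measurable discrete_measurable0
  discrete_measurableC discrete_measurableU.

End discr.

HB.instance Definition _ (I : finType) (T : I -> finPointedType) :=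
  isPointed.Build {dffun forall i, T i} [ffun i => point].

Section finite_mixture.
Context d (Y : measurableType d) (R : realType) (T : finType).
Variables (w : T -> \bar R) (k : T -> {measure set Y -> \bar R}).
Hypotheses (w_ge0 : forall x, 0 <= w x) (w_fin : forall x, w x \is a fin_num).

Lemma mixture0 : \sum_(x : T) w x * k x set0 = 0.
Proof. by rewrite big1// => x _; rewrite measure0 mule0. Qed.

Lemma mixture_ge0 A : 0 <= \sum_(x : T) w x * k x A.
Proof. by apply: sume_ge0 => x _; exact: mule_ge0. Qed.

Lemma mixture_sigma_additive :
  semi_sigma_additive (fun A => \sum_(x : T) w x * k x A).
Proof.
move=> F mF tF mUF.
rewrite (_ : (fun n => _) = (fun n =>
    \sum_(x : T) (w x * \sum_(0 <= i < n) k x (F i)))); last first.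
  apply/funext => n; rewrite exchange_big /=; apply: eq_bigr => x _.
  by rewrite ge0_sume_distrr.
apply: cvg_nnesum => x _.
  by apply: nearW => n; apply: mule_ge0 => //; exact: sume_ge0.
by apply: cvgeZl => //; exact: measure_semi_sigma_additive.
Qed.

End finite_mixture.

Lemma sum_prob_set1 (R : realType) (T : finPointedType)
    (P : probability (discr T) R) : \sum_(x : T) P [set x] = 1.
Proof.
rewrite -(@probability_setT _ _ _ P).
have -> : [set: discr T] =
    \big[setU/set0]_(i < #|T|) [set (enum_val i : discr T)].
  apply/seteqP; split => // x _.
  by rewrite (bigD1 (enum_rank x))//=; left; rewrite /= enum_rankK.
rewrite measure_bigsetU_ord//; last first.
  by move=> i j _ _ [z [/= -> /enum_val_inj]].
rewrite (reindex (@enum_val T predT)) //=.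
by apply/onW_bij/enum_val_bij.
Qed.

Lemma prob_set1_fin_num (R : realType) (T : finPointedType)
    (P : probability (discr T) R) (x : T) : P [set x] \is a fin_num.
Proof. exact: fin_num_measure. Qed.

Section product_probability.
Context (R : realType) (m : nat) (X : 'I_m -> finPointedType).
Variable P : forall j, probability (discr (X j)) R.

Definition prodP (A : set (discr {dffun forall j, X j})) : \bar R :=
  \sum_(x : {dffun forall j, X j} | x \in A) \prod_(j < m) P j [set x j].

Let w (x : {dffun forall j, X j}) : \bar R := \prod_(j < m) P j [set x j].

Let w0 x : 0 <= w x.
Proof. by apply: prode_ge0 => j _; exact: measure_ge0. Qed.

Let w_fin x : w x \is a fin_num.
Proof.
rewrite /w; elim/big_ind : _ => // [a b|j _]; first exact: fin_numM.
exact: prob_set1_fin_num.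
Qed.

Let prodPE : prodP = fun A => \sum_(x : {dffun forall j, X j})
  w x * (\d_(x : discr {dffun forall j, X j}) : {measure set _ -> \bar R}) A.
Proof.
apply/funext => A; rewrite /prodP big_mkcond; apply: eq_bigr => x _.
by rewrite /= diracE; case: ifPn => _; rewrite ?mule1 ?mule0.
Qed.

Let prodP_set0 : prodP set0 = 0.
Proof. by rewrite prodPE mixture0. Qed.

Let prodP_ge0 A : 0 <= prodP A.
Proof. by rewrite prodPE; exact: mixture_ge0. Qed.

Let prodP_sigma_additive : semi_sigma_additive prodP.
Proof. by rewrite prodPE; exact: mixture_sigma_additive. Qed.

HB.instance Definition _ := isMeasure.Build _ _ _ prodP
  prodP_set0 prodP_ge0 prodP_sigma_additive.

Let prodP_setT : prodP setT = 1.
Proof.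
pose p j := [ffun x : X j => fine (P j [set x])] : {ffun X j -> R}.
have pE j x : P j [set x] = (p j x)%:E.
  by rewrite ffunE fineK// prob_set1_fin_num.
have p1 j : (\sum_(x : X j) p j x = 1)%R.
  apply: EFin_inj; rewrite -(sum_prob_set1 (P j)) -sumEFin.
  by apply: eq_bigr => x _; rewrite pE.
clearbody p; rewrite /prodP (eq_bigl xpredT); last by move=> x; rewrite in_setT.
under eq_bigr do (under eq_bigr do rewrite pE; rewrite prodEFin).
rewrite sumEFin; congr EFin.
rewrite (reindex (@dffun_of_fprod _ X)) /=; last first.
  exact/onW_bij/dffun_of_fprod_bij.
have dE t j : dffun_of_fprod t j = t j :> X j by rewrite ffunE.
under eq_bigr do under eq_bigr do rewrite dE.
rewrite (big_fprod _ _ p).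
rewrite -(bigA_distr_big_dep _
  (fun i (j : {i : 'I_m & X i}) => untag 0%R (p i) j)).
rewrite big1// => j _; rewrite -[RHS](p1 j).
exact/esym/(big_tag (fun i => p i)).
Qed.

HB.instance Definition _ := Measure_isProbability.Build _ _ _ prodP prodP_setT.

End product_probability.

Section output_distribution.
Context d (Y : measurableType d) (R : realType) (T : finPointedType).
Variables (Q : R.-pker (discr T) ~> Y) (P : probability (discr T) R).

Definition outdist (B : set Y) : \bar R := \sum_(x : T) Q x B * P [set x].

Let outdistE : outdist = fun B => \sum_(x : T) P [set x] * Q x B.
Proof. by apply/funext => B; apply: eq_bigr => x _; rewrite muleC. Qed.

Let outdist0 : outdist set0 = 0.
Proof. by rewrite outdistE mixture0. Qed.

Let outdist_ge0 B : 0 <= outdist B.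
Proof. by rewrite outdistE; apply: mixture_ge0 => x; exact: measure_ge0. Qed.

Let outdist_sigma_additive : semi_sigma_additive outdist.
Proof.
by rewrite outdistE; apply: mixture_sigma_additive => x;
  [exact: measure_ge0|exact: prob_set1_fin_num].
Qed.

HB.instance Definition _ := isMeasure.Build _ _ _ outdist
  outdist0 outdist_ge0 outdist_sigma_additive.

Let outdist_setT : outdist setT = 1.
Proof.
rewrite /outdist -(sum_prob_set1 P); apply: eq_bigr => x _.
by rewrite prob_kernel mul1e.
Qed.

HB.instance Definition _ :=
  Measure_isProbability.Build _ _ _ outdist outdist_setT.

End output_distribution.

Definition is_coupling (R : realType) (m : nat) (X : 'I_m -> finPointedType)
    (P : forall j, probability (discr (X j)) R)
    (PX : probability (discr {dffun forall j, X j}) R) : Prop :=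
  forall (j : 'I_m) (A : set (discr (X j))),
    pushforward PX
      ((fun x => x j) : discr {dffun forall i, X i} -> discr (X j)) A = P j A.

(* The integrand is [-oo] where the density vanishes; the negative part of the
   integrand is always integrable, so the integral is never [+oo - +oo]. *)
Definition relent d (T : measurableType d) (R : realType)
    (P Q : probability T R) : \bar R :=
  if `[< P `<< Q >] then
    \int[P]_x lne (Radon_Nikodym (charge_of_finite_measure P) Q x)
  else +oo.

(* At most one of the positive and negative parts of [f] has an infinite
   integral; the library's [integral] would read [+oo - +oo] as [-oo]. *)
Definition has_integral d (T : measurableType d) (R : realType)
    (mu : {measure set T -> \bar R}) (f : T -> \bar R) : Prop :=
  \int[mu]_x (f^\+ x) < +oo \/ \int[mu]_x (f^\- x) < +oo.

(* Main.v *)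
(* Both directions rest on the variational formula
   D(P || Q) = sup_F { \int ln F dP | \int F dQ <= 1 }.

   From 2) to 1), apply 2) to the tilted marginals P_j = f_j Q_j / \int f_j dQ_j;
   under the coupling, the hypothesis on F and the variational formula for the
   output distribution give the inequality.

   From 1) to 2), the coupling is found by a minimax argument. Fix
   s = \sum_j c_j D(P_j || Q_j) - d and consider the functions on the product
   alphabet bounded above by
     t (\int ln F dQ_{Y|x} - s) - \sum_j phi_j(x_j),
   where t >= 0, \int F dR_Y <= 1 and every phi_j has mean zero under P_j.
   They form a convex cone, because ln is concave. By 1) applied to
   f_j = exp(phi_j / c_j) and Gibbs' inequality, the cone contains no positive
   function, so some probability vector on the product alphabet is nonpositive
   on it. The choice t = 0 shows that this vector is a coupling, and the choice
   phi = 0 bounds its output divergence by s. *)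

From HB Require Import structures.
Require Import Defs.
From mathcomp Require Import measurable_realfun ring lra.

Set Implicit Arguments.
Unset Strict Implicit.
Unset Printing Implicit Defensive.

Import Order.TTheory GRing.Theory Num.Theory.
Import numFieldNormedType.Exports.

Local Open Scope classical_set_scope.
Local Open Scope ring_scope.
Local Open Scope ereal_scope.

(** * Separation of a convex cone from the positive orthant *)

Section cone_separation.
Local Open Scope ring_scope.
Context (R : realType) (T : finType).
Implicit Types (H : set (T -> R)) (e g h : T -> R).

Lemma finite_positive_bound g : (forall x, 0 < g x) ->
  exists2 eps, 0 < eps & forall x, eps <= g x.
Proof.
move=> g0; exists (\big[Num.min/1]_(x : T) g x).
  by elim/big_ind : _ => // a b a0 b0; rewrite lt_min a0.
by move=> x; exact: bigmin_le_cond.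
Qed.

Lemma finite_abs_bound g : exists2 M, 0 <= M & forall x, `|g x| <= M.
Proof.
exists (\sum_x `|g x|) => [|x]; first exact: sumr_ge0.
by rewrite (bigD1 x)//= lerDl sumr_ge0.
Qed.

Definition convex_cone H := H (fun=> 0) /\
  forall g h a b, 0 <= a -> 0 <= b -> H g -> H h ->
    H (fun x => a * g x + b * h x).

Definition avoids_positive H := forall h, H h -> exists x, h x <= 0.

(** The cone generated by [H] and the whole line through [e - a]. Since [s] takes both signs, a
    functional that is nonpositive on it must send [e] to [a] times its total mass. *)
Definition cone_adjoin H e a : set (T -> R) :=
  [set g | exists2 h, H h & exists s, forall x, g x = h x + s * (e x - a)].

Lemma cone_adjoin_sub H e a : H `<=` cone_adjoin H e a.
Proof. by move=> h Hh; exists h => //; exists 0 => x; rewrite mul0r addr0. Qed.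

Lemma convex_cone_adjoin H e a : convex_cone H -> convex_cone (cone_adjoin H e a).
Proof.
move=> [H0 HD]; split; first exact: cone_adjoin_sub.
move=> g h u v u0 v0 [g' Hg' [s gE]] [h' Hh' [t hE]].
exists (fun x => u * g' x + v * h' x); first exact: HD.
by exists (u * s + v * t) => x; rewrite gE hE; ring.
Qed.

(** One Hahn-Banach step. The witness is the supremum of the constants [c] with [c <= e + h] for
    some [h] in [H]. A positive [h + s (e - a)] exceeds some [eps > 0]. After division by [|s|] this
    puts a larger constant in that set if [s > 0], and gives a smaller upper bound if [s < 0]. *)
Lemma avoids_positive_adjoin H e : convex_cone H -> avoids_positive H ->
  exists a, avoids_positive (cone_adjoin H e a).
Proof.
move=> [H0 HD] Hpos; have [M M0 eM] := finite_abs_bound e.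
pose L := [set c | exists2 h, H h & forall x, c <= e x + h x].
have L0 : L !=set0.
  by exists (- M), (fun=> 0) => // x; have := eM x; rewrite ler_norml addr0 => /andP[].
(* Bounded above, since each [h] in the cone is nonpositive somewhere. *)
have LM : ubound L M.
  move=> c [h Hh ch]; have [x hx] := Hpos _ Hh.
  have := ch x; have := eM x; rewrite ler_norml => /andP[_]; lra.
have Lsup : has_sup L by split => //; exists M.
exists (sup L) => g [h Hh [s gE]]; apply: contrapT => /forallNP g0.
have {}g0 x : 0 < g x by rewrite ltNge; exact/negP/g0.
have [eps eps0 geps] := finite_positive_bound g0.
have scale t : 0 <= t -> H (fun x => t * h x).
  move=> t0; have := HD _ _ t 0 t0 (lexx _) Hh H0.
  by congr (H _); apply/funext => x; rewrite mulr0 addr0.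
have [s0|s0|s0] := ltgtP s 0.
- have t0 : 0 < - s^-1 by rewrite oppr_gt0 invr_lt0.
  suff /(ge_sup L0) : ubound L (sup L + s^-1 * eps) by nra.
  move=> c [h' Hh' ch'].
  have [x] := Hpos _ (HD _ _ 1 1 ler01 ler01 Hh' (scale _ (ltW t0))).
  have := ch' x; have := geps x; rewrite gE => h1 h2 h3.
  have s1 : - s^-1 * s = -1 by rewrite mulNr mulVf// lt_eqF.
  have : - s^-1 * eps <= - s^-1 * (h x + s * (e x - sup L)) by rewrite ler_pM2l.
  rewrite mulrDr mulrA s1; lra.
- have t0 : 0 < s^-1 by rewrite invr_gt0.
  suff /(ub_le_sup (ex_intro _ M LM)) : L (sup L + s^-1 * eps) by nra.
  exists (fun x => s^-1 * h x); first exact/scale/ltW.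
  move=> x; have := geps x; rewrite gE -(ler_pM2l t0) mulrDr mulrA mulVf ?gt_eqF//; lra.
- have [x hx] := Hpos _ Hh.
  by have := g0 x; rewrite gE s0 mul0r addr0 ltNge hx.
Qed.

Lemma avoids_positive_extend H (E : T -> T -> R) (r : seq T) :
  convex_cone H -> avoids_positive H ->
  exists p : T -> R, exists H',
    [/\ convex_cone H', avoids_positive H', H `<=` H' & forall y, y \in r ->
       forall s, H' (fun x => s * (E y x - p y))].
Proof.
move=> cH aH; elim: r => [|y r [p [H' [cH' aH' HH' Hr]]]].
  by exists (fun=> 0), H; split.
have [a aHa] := avoids_positive_adjoin (E y) cH' aH'.
exists (fun z => if z == y then a else p z), (cone_adjoin H' (E y) a).
split=> //; first exact: convex_cone_adjoin.
  by move=> h /HH'; exact: cone_adjoin_sub.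
move=> z; rewrite inE; have [->{z} _ s|zy /= zr s] := eqVneq z y; last first.
  by apply: cone_adjoin_sub; exact: Hr.
by exists (fun=> 0); [exact: cH'.1|exists s => x; rewrite add0r].
Qed.

(* The separating functional is built one coordinate at a time: its value
   [p x] at the basis vector of [x] is chosen so that the line spanned by
   [basis vector - p x] can be added to the cone. *)
Lemma cone_separation H : convex_cone H ->
  (forall g h, (forall x, g x <= h x) -> H h -> H g) -> avoids_positive H ->
  exists p : T -> R, [/\ forall x, 0 <= p x, \sum_x p x = 1 &
    forall h, H h -> \sum_x p x * h x <= 0].
Proof.
move=> cH dH aH.
pose E (y x : T) : R := (x == y)%:R.
have [p [H' [cH' aH' HH' HE]]] := avoids_positive_extend E (enum T) cH aH.
(* [H'] contains the deviation of every [g] from its [p]-weighted sum: expand [g] in the basis and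
   add up the adjoined lines. *)
have sum0 (g : T -> R) : H' (fun x => g x - \sum_y p y * g y).
  have : H' (fun x => \sum_(y : T) g y * (E y x - p y)).
    have : forall r : seq T, H' (fun x => \sum_(y <- r) g y * (E y x - p y)).
      elim=> [|y r IH].
        by have := cH'.1; congr H'; apply/funext => x; rewrite big_nil.
      have := cH'.2 _ _ 1 1 ler01 ler01 (HE y _ (g y)) IH.
      move=> /(_ (mem_enum _ _)); congr H'; apply/funext => x.
      by rewrite big_cons !mul1r.
    exact.
  congr H'; apply/funext => x.
  under eq_bigr do rewrite mulrBr.
  rewrite sumrB; congr (_ - _); last by apply: eq_bigr => y _; rewrite mulrC.
  rewrite (bigD1 x)//= /E eqxx mulr1 big1 ?addr0// => y yx.
  by rewrite eq_sym (negbTE yx) mulr0.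
(* Adding [h] to the deviation of [- h] leaves the constant [\sum_x p x * h x], which must be
   nonpositive somewhere. *)
have le0 h : H h -> \sum_x p x * h x <= 0.
  move=> Hh; have := cH'.2 _ _ 1 1 ler01 ler01 (HH' _ Hh) (sum0 (fun x => - h x)).
  move=> /aH'[x]; rewrite !mul1r.
  by under eq_bigr do rewrite mulrN; rewrite sumrN; lra.
exists p; split=> //.
- move=> y; have := le0 (fun x => - E y x); rewrite (bigD1 y)//= big1; last first.
    by move=> x xy; rewrite /E (negbTE xy) oppr0 mulr0.
  rewrite /E eqxx mulrN mulr1 addr0 oppr_le0; apply.
  by apply: (dH _ (fun=> 0)); [move=> x; rewrite oppr_le0 ler0n|exact: cH.1].
(* The deviations of [1] and [-1] are opposite constants, both nonpositive. *)
- have [x /=] := aH' _ (sum0 (fun=> 1)); have [z /=] := aH' _ (sum0 (fun=> -1)).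
  have -> : \sum_y p y * -1 = - \sum_y p y.
    by rewrite -sumrN; apply: eq_bigr => y _; rewrite mulrN1.
  under eq_bigr do rewrite mulr1.
  lra.
Qed.

End cone_separation.

(** * Mixtures and finite alphabets *)

Lemma big_enum_nth (I V : Type) (idx : V) (op : Monoid.com_law idx)
    (T : finType) (x0 : T) (F : T -> V) :
  \big[op/idx]_(n < #|T|) F (nth x0 (enum T) n) = \big[op/idx]_x F x.
Proof.
by rewrite -[RHS]big_enum /= (big_nth x0) big_mkord -cardE.
Qed.

Section mixture.
Context d (Y : measurableType d) (R : realType) (T : finPointedType).
Variables (w : T -> R) (k : T -> {measure set Y -> \bar R})
  (mu : {measure set Y -> \bar R}).
Hypotheses (w_ge0 : forall x, (0 <= w x)%R)
  (muE : forall B, measurable B -> mu B = \sum_(x : T) (w x)%:E * k x B).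

(** Along an enumeration of the alphabet, [mu] is a finite sum of scaled measures, and the integral
    is additive in the measure. *)
Lemma ge0_integral_mixture (f : Y -> \bar R) :
  (forall y, 0 <= f y) -> measurable_fun [set: Y] f ->
  \int[mu]_y f y = \sum_(x : T) (w x)%:E * \int[k x]_y f y.
Proof.
move=> f0 mf.
pose e n := nth (point : T) (enum T) n.
pose m_ n : {measure set Y -> \bar R} := mscale (NngNum (w_ge0 (e n))) (k (e n)).
rewrite (eq_measure_integral (msum m_ #|T|)); last first.
  move=> A mA _; rewrite muE// /msum /m_ /mscale/=.
  by rewrite -(@big_enum_nth T _ _ _ _ (point : T)).
rewrite ge0_integral_measure_sum//.
rewrite -(@big_enum_nth T _ _ _ _ (point : T)).
by apply: eq_bigr => n _; rewrite ge0_integral_mscale.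
Qed.

Lemma integrable_mixture (f : Y -> \bar R) x :
  mu.-integrable setT f -> (0 < w x)%R -> (k x).-integrable setT f.
Proof.
move=> /integrableP[mf fi] wx; apply/integrableP; split => //.
move: fi; rewrite ge0_integral_mixture//; last exact: measurableT_comp.
rewrite (bigD1 x)//= => /(le_lt_trans _) h.
have : (w x)%:E * \int[k x]_y `|f y| < +oo.
  apply: h; rewrite leeDl// sume_ge0// => z _.
  by rewrite mule_ge0 ?lee_fin ?integral_ge0.
by apply: contraTT; rewrite -!leNgt !leye_eq => /eqP ->; rewrite gt0_muley.
Qed.

Lemma integral_mixture (f : Y -> \bar R) : mu.-integrable setT f ->
  \int[mu]_y f y = \sum_(x : T) (w x)%:E * \int[k x]_y f y.
Proof.
move=> fi; have mf := measurable_int _ fi.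
rewrite integralE !ge0_integral_mixture//; last 2 first.
- exact: measurable_funeneg.
- exact: measurable_funepos.
have fin x g : (0 < w x)%R -> mu.-integrable setT g ->
    \int[k x]_y g y \is a fin_num.
  by move=> wx gi; apply: integrable_fin_num => //; exact: integrable_mixture.
rewrite -fin_num_sumeN; last first.
  (* Letters of weight zero are treated apart: [f] need not be integrable under their [k x]. *)
  move=> x _; have [->|wx] := eqVneq (w x) 0%R; first by rewrite mul0e.
  by rewrite fin_numM// fin ?lt0r ?wx ?w_ge0//; exact: integrable_funeneg.
rewrite -big_split/=; apply: eq_bigr => x _.
have [->|wx] := eqVneq (w x) 0%R; first by rewrite !mul0e oppe0 adde0.
rewrite [in RHS]integralE; apply/esym/muleBr => //; apply: fin_num_adde_defr.
by rewrite fin ?lt0r ?wx ?w_ge0//; exact: integrable_funepos.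
Qed.

End mixture.

(** * Point masses on a finite alphabet *)

Section mass.
Context (R : realType) (T : finPointedType).
Implicit Types P Q : probability (discr T) R.

Definition mass P (x : T) : R := fine (P [set x]).

Lemma massE P x : P [set x] = (mass P x)%:E.
Proof. by rewrite fineK// prob_set1_fin_num. Qed.

Lemma mass_ge0 P x : (0 <= mass P x)%R.
Proof. exact: fine_ge0. Qed.

Lemma mass_sum P : (\sum_x mass P x = 1)%R.
Proof.
apply: EFin_inj; rewrite -(sum_prob_set1 P) -sumEFin.
by under eq_bigr do rewrite -massE.
Qed.

Lemma measurable_fun_discr d (Y : measurableType d) (f : discr T -> Y) :
  measurable_fun setT f.
Proof. by move=> _ B _. Qed.

(** Presents [P] as a mixture of Dirac measures, so that the mixture lemmas turn integrals over the
    alphabet into sums. *)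
Lemma mass_dirac P (A : set (discr T)) :
  P A = \sum_(x : T) (mass P x)%:E * \d_(x : discr T) A.
Proof.
have AE : A = \big[setU/set0]_(i < #|T| | (enum_val i : discr T) \in A)
    [set (enum_val i : discr T)].
  rewrite -bigcup_pred; apply/seteqP; split => [x Ax|x [i /= iA ->]].
    exists (enum_rank (x : T)); rewrite /= ?enum_rankK//.
    by apply/asboolP; rewrite enum_rankK.
  exact/asboolP.
rewrite [in LHS]AE measure_bigsetU_ord//; last first.
  by move=> i j _ _ [z [/= -> /enum_val_inj]].
rewrite [RHS](reindex (@enum_val T predT)) /=; last exact/onW_bij/enum_val_bij.
rewrite big_mkcond/=; apply: eq_bigr => i _.
by rewrite massE diracE; case: ifPn => _; rewrite ?mule1 ?mule0.
Qed.

Lemma ge0_integral_discr P (f : T -> \bar R) : (forall x, 0 <= f x) ->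
  \int[P]_x f x = \sum_x (mass P x)%:E * f x.
Proof.
move=> f0; rewrite (ge0_integral_mixture (w := mass P)
    (k := fun x : T => \d_(x : discr T)))//; last 2 first.
- exact: mass_ge0.
- by move=> B _; exact: mass_dirac.
by apply: eq_bigr => x _; rewrite integral_dirac// diracT mul1e.
Qed.

Lemma integrable_discr P (f : T -> R) :
  P.-integrable setT (fun x : discr T => (f x)%:E).
Proof.
apply/integrableP; split; first exact: measurable_fun_discr.
rewrite ge0_integral_discr//; apply: lte_sum_pinfty => x _.
by rewrite /= -EFinM ltry.
Qed.

Lemma integral_discr P (f : T -> R) :
  \int[P]_x (f x)%:E = (\sum_x mass P x * f x)%:E.
Proof.
rewrite (integral_mixture (w := mass P) (k := fun x : T => \d_(x : discr T)));
  last 3 first.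
- exact: mass_ge0.
- by move=> B _; exact: mass_dirac.
- exact: integrable_discr.
rewrite -sumEFin; apply: eq_bigr => x _.
by rewrite integral_dirac//= ?diracT ?mul1e//; exact: measurable_fun_discr.
Qed.

End mass.

Section mass_theory.
Context (R : realType) (T : finPointedType).
Implicit Types P Q : probability (discr T) R.

Lemma ae_mass_gt0 P : {ae P, forall x : discr T, (0 < mass P x)%R}.
Proof.
exists [set x : discr T | ~ (0 < mass P x)%R]; split => //.
rewrite mass_dirac big1// => x _; rewrite diracE.
case: (boolP (_ \in _)) => [|_]; last by rewrite mule0.
rewrite inE/= => /negP; rewrite -leNgt => px.
by rewrite (_ : mass P x = 0%R) ?mul0e//; apply/eqP; rewrite eq_le px mass_ge0.
Qed.

Lemma ae_discrP P (A : discr T -> Prop) :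
  {ae P, forall x, A x} -> forall x, (0 < mass P x)%R -> A x.
Proof.
move=> [N [mN PN AN]] x px; apply: contrapT => /AN Nx.
have : (mass P x)%:E <= P N.
  by rewrite -massE; apply: le_measure; rewrite ?inE// => _ ->.
by rewrite PN lee_fin leNgt px.
Qed.

Lemma null_dominates_mass P Q x : P `<< Q -> mass Q x = 0%R -> mass P x = 0%R.
Proof.
move=> /null_content_dominatesP PQ Qx; apply: EFin_inj; rewrite -massE.
by apply: PQ => //; rewrite -[RHS]/(0%:E) -Qx -massE.
Qed.

Lemma mass_null_dominates P Q :
  (forall x, mass Q x = 0%R -> mass P x = 0%R) -> P `<< Q.
Proof.
move=> PQ; apply/null_content_dominatesP => A _ QA.
rewrite mass_dirac big1// => x _; rewrite diracE.
case: (boolP (_ \in _)) => [|_]; last by rewrite mule0.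
rewrite inE => Ax; rewrite mule1 PQ//; apply: EFin_inj; rewrite -massE.
by apply/eqP; rewrite -measure_le0 -QA le_measure ?inE// => _ ->.
Qed.

(** Integrating the Radon-Nikodym derivative over a singleton identifies it with the ratio of the
    masses wherever [P] has mass. The other letters are [P]-negligible and contribute zero to the
    sum. *)
Lemma relent_discr P Q : P `<< Q ->
  relent P Q = (\sum_(x : T) mass P x * ln (mass P x / mass Q x))%:E.
Proof.
move=> PQ; rewrite /relent asboolT//.
set f := Radon_Nikodym (charge_of_finite_measure P) Q.
have ffin x : f x \is a fin_num by exact: Radon_Nikodym_fin_num.
have fE (x : T) : (mass P x = mass Q x * fine (f x))%R.
  apply: EFin_inj; rewrite -massE.
  have -> : P [set x] = \int[Q]_(y in [set x]) f y.
    by rewrite -Radon_Nikodym_integral.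
  rewrite integral_mkcond.
  rewrite (eq_integral (fun y : discr T => (fine ((f \_ [set x]) y))%:E)).
    rewrite integral_discr (bigD1 x)//= big1 ?addr0 ?patchE ?mem_set//.
    by move=> y yx; rewrite patchE memNset ?mulr0//; exact/eqP.
  by move=> y _; rewrite fineK// patchE; case: ifP.
rewrite -integral_discr; apply: ae_eq_integral => //.
apply: filterS (ae_mass_gt0 P) => x px _.
have qx : (0 < mass Q x)%R.
  rewrite lt0r mass_ge0 andbT; apply: contraTneq px => qx.
  by rewrite fE qx mul0r ltxx.
have -> : (mass P x / mass Q x = fine (f x))%R.
  by rewrite fE mulrAC divff ?gt_eqF// mul1r.
rewrite -[f x in LHS]fineK// lne_EFin//.
by move: px; rewrite fE pmulr_rgt0.
Qed.

Section probability_of_mass.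
Variable w : T -> R.

(** The proofs of nonnegativity and of total mass one are arguments, so that the measure and
    probability instances can be recovered from the term. *)
Definition weighted (_ : forall x, (0 <= w x)%R) (_ : (\sum_x w x = 1)%R)
    (A : set (discr T)) : \bar R :=
  \sum_(x : T) (w x)%:E * (\d_(x : discr T) : {measure set _ -> \bar R}) A.

Variables (w0 : forall x, (0 <= w x)%R) (w1 : (\sum_x w x = 1)%R).

Let weighted0 : weighted w0 w1 set0 = 0.
Proof. exact: mixture0. Qed.

Let weighted_ge0 A : 0 <= weighted w0 w1 A.
Proof. by apply: mixture_ge0 => x; rewrite lee_fin. Qed.

Let weighted_sigma_additive : semi_sigma_additive (weighted w0 w1).
Proof. by apply: mixture_sigma_additive => // x; rewrite lee_fin. Qed.

HB.instance Definition _ := isMeasure.Build _ _ _ (weighted w0 w1)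
  weighted0 weighted_ge0 weighted_sigma_additive.

Let weighted_setT : weighted w0 w1 setT = 1.
Proof.
rewrite /weighted -w1 -sumEFin.
by apply: eq_bigr => x _; rewrite /= diracT mule1.
Qed.

HB.instance Definition _ := Measure_isProbability.Build _ _ _
  (weighted w0 w1) weighted_setT.

Lemma probability_of_mass :
  exists P : probability (discr T) R, forall x, mass P x = w x.
Proof.
exists (weighted w0 w1) => x; rewrite /mass /= /weighted (bigD1 x)//= big1.
  by rewrite diracE mem_set// mule1 addr0.
move=> y yx; rewrite diracE memNset ?mule0//= => yx'.
by rewrite yx' eqxx in yx.
Qed.

End probability_of_mass.

End mass_theory.

(** * Logarithm bounds and Gibbs' inequality *)

Section log_inequalities.
Context (R : realType).
Local Open Scope ring_scope.

Lemma ln_le_subr1 (x : R) : 0 < x -> ln x <= x - 1.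
Proof.
move=> x0; have := @le_ln1Dx R (x - 1); rewrite [(1 + _)%R]addrC subrK.
by apply; lra.
Qed.

(** The finite Donsker-Varadhan bound. Let [Z] be the sum on the right. Apply [ln t <= t - 1] with
    [t = q exp(psi) / (p Z)] at each letter of positive [p]-mass and sum: [p] and [q exp(psi) / Z]
    have the same total, so the linear terms cancel. *)
Lemma gibbs (T : finType) (p q psi : T -> R) :
  (forall x, 0 <= p x) -> \sum_x p x = 1 -> (forall x, 0 <= q x) ->
  (forall x, q x = 0 -> p x = 0) ->
  \sum_x p x * psi x - \sum_x p x * ln (p x / q x) <=
    ln (\sum_x q x * expR (psi x)).
Proof.
move=> p0 p1 q0 pq; set Z := \sum_x q x * expR _.
have term0 x : 0 <= q x * expR (psi x) by rewrite mulr_ge0// expR_ge0.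
have [x px] : exists x, p x != 0.
  apply/existsP; apply: contraPT p1; rewrite negb_exists => /forallP p00.
  rewrite big1; last by move=> x _; apply/eqP; have := p00 x; rewrite negbK.
  by move/esym/eqP; rewrite oner_eq0.
have Z0 : 0 < Z.
  rewrite /Z (bigD1 x)//= ltr_pwDl ?sumr_ge0// mulr_gt0 ?expR_gt0// lt0r q0 andbT.
  by apply: contra_neq px; exact: pq.
rewrite -sumrB -[leRHS]mul1r -{1}p1 mulr_suml -subr_ge0 -sumrB.
have qZ : \sum_x (p x - q x * expR (psi x) / Z) = 0.
  by rewrite sumrB p1 -mulr_suml divff ?gt_eqF// subrr.
rewrite -[leLHS]qZ; apply: ler_sum => y _.
have [->|py] := eqVneq (p y) 0.
  by rewrite !mul0r; have := divr_ge0 (term0 y) (ltW Z0); lra.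
have {}py : 0 < p y by rewrite lt0r py p0.
have qy : 0 < q y by rewrite lt0r q0 andbT; apply: contra_neq (lt0r_neq0 py); exact: pq.
have e0 := expR_gt0 (psi y).
have t0 : 0 < q y * expR (psi y) / (p y * Z) by rewrite divr_gt0 ?mulr_gt0.
have : p y * ln (q y * expR (psi y) / (p y * Z)) <=
    p y * (q y * expR (psi y) / (p y * Z) - 1).
  by rewrite ler_pM2l//; exact: ln_le_subr1.
have -> : p y * (q y * expR (psi y) / (p y * Z) - 1) =
    q y * expR (psi y) / Z - p y by field; rewrite !gt_eqF.
have -> : ln (q y * expR (psi y) / (p y * Z)) =
    ln (q y) + psi y - (ln (p y) + ln Z).
  by rewrite ln_div ?posrE ?mulr_gt0// lnM ?posrE// lnM ?posrE// expRK.
by rewrite ln_div ?posrE//; lra.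
Qed.

End log_inequalities.

(** * Couplings *)

Lemma prob_mass (R : realType) (T : finPointedType) (P : probability (discr T) R)
    (A : set (discr T)) :
  P A = (\sum_(x : T) mass P x * (x \in A)%:R)%:E.
Proof.
rewrite mass_dirac -sumEFin; apply: eq_bigr => x _.
by rewrite EFinM diracE.
Qed.

Section coupling.
Local Open Scope ring_scope.
Context (R : realType) (m : nat) (X : 'I_m -> finPointedType).
Variable PX : forall j, probability (discr (X j)) R.
Implicit Types PXm : probability (discr {dffun forall j, X j}) R.

(** By linearity it suffices to treat indicators of letters, where it is the marginal condition on
    singletons. *)
Lemma coupling_expectation PXm (j : 'I_m) (psi : X j -> R) :
  is_coupling PX PXm ->
  \sum_(x : {dffun forall j, X j}) mass PXm x * psi (x j) =
  \sum_(a : X j) mass (PX j) a * psi a.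
Proof.
move=> cP.
have PE (a : X j) : mass (PX j) a =
    \sum_(x : {dffun forall j, X j}) mass PXm x * (x j == a)%:R.
  apply: EFin_inj; rewrite -massE -cP /pushforward prob_mass; congr EFin.
  apply: eq_bigr => x _; congr (_ * _%:R); congr nat_of_bool.
  by apply/idP/eqP; [rewrite inE|move=> <-; rewrite inE].
under [RHS]eq_bigr do rewrite PE mulr_suml.
rewrite exchange_big/=; apply: eq_bigr => x _.
rewrite (bigD1 (x j))//= eqxx mulr1 big1 ?addr0// => a ax.
by rewrite eq_sym (negbTE ax) mulr0 mul0r.
Qed.

(** The marginal mass of a letter sums the masses of all words that carry it. *)
Lemma coupling_mass_gt0 PXm x j : is_coupling PX PXm ->
  0 < mass PXm x -> 0 < mass (PX j) (x j).
Proof.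
move=> cP px.
have := coupling_expectation (fun a : X j => (a == x j)%:R) cP.
rewrite (bigD1 x)//= eqxx mulr1 (bigD1 (x j))//= eqxx mulr1.
rewrite [X in _ = _ + X]big1 ?addr0; last first.
  by move=> a ax; rewrite (negbTE ax) mulr0.
by move=> <-; rewrite ltr_pwDl// sumr_ge0// => y _; rewrite mulr_ge0// mass_ge0.
Qed.

Lemma mass_prodP (x : {dffun forall j, X j}) :
  mass (prodP PX) x = \prod_(j < m) mass (PX j) (x j).
Proof.
apply: EFin_inj; rewrite -massE /= /prodP -prodEFin (bigD1 x)/=; last by rewrite inE.
rewrite [X in (_ + X)%R]big1 ?addr0.
  by apply: eq_bigr => j _; exact: massE.
by move=> y /andP[]; rewrite inE => -> /=; rewrite eqxx.
Qed.

(** [K] encodes the constraints wanted of the coupling besides its marginals. Subtracting zero-mean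
    potentials from [K] and closing downwards gives a cone without positive functions. The
    separating vector is nonpositive on [K], and the potentials alone force its marginals. *)
Lemma exists_coupling (K : set ({dffun forall j, X j} -> R)) :
  convex_cone K ->
  (forall k (phi : forall j, X j -> R), K k ->
    (forall j, \sum_a mass (PX j) a * phi j a = 0) ->
    exists x, k x <= \sum_(j < m) phi j (x j)) ->
  exists2 PXm, is_coupling PX PXm &
    forall k, K k -> \sum_x mass PXm x * k x <= 0.
Proof.
move=> cK Kphi.
pose H := [set h : {dffun forall j, X j} -> R | exists2 k, K k &
  exists2 phi : forall j, X j -> R,
    forall j, \sum_a mass (PX j) a * phi j a = 0 &
    forall x, h x <= k x - \sum_(j < m) phi j (x j)].
have cH : convex_cone H.
  split.
    exists (fun=> 0); first exact: cK.1.
    exists (fun _ _ => 0); first by move=> j; rewrite big1// => a _; rewrite mulr0.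
    by move=> x; rewrite big1 ?subr0.
  move=> g h a b a0 b0 [k Kk [phi phi0 gk]] [l Kl [psi psi0 hl]].
  exists (fun x => a * k x + b * l x); first exact: cK.2.
  exists (fun j z => a * phi j z + b * psi j z).
    move=> j; transitivity (a * \sum_z mass (PX j) z * phi j z +
        b * \sum_z mass (PX j) z * psi j z); last by rewrite phi0 psi0; ring.
    by rewrite !mulr_sumr -big_split/=; apply: eq_bigr => z _; ring.
  move=> x; rewrite big_split/= -!mulr_sumr.
  have := ler_wpM2l a0 (gk x); have := ler_wpM2l b0 (hl x); lra.
have dH g h : (forall x, g x <= h x) -> H h -> H g.
  move=> gh [k Kk [phi phi0 hk]]; exists k => //; exists phi => // x.
  exact: le_trans (hk x).
have aH : avoids_positive H.
  move=> h [k Kk [phi phi0 hk]]; have [x kx] := Kphi _ _ Kk phi0.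
  by exists x; apply: le_trans (hk x) _; rewrite subr_le0.
have [p [p0 p1 pH]] := cone_separation cH dH aH.
have [PXm PXmE] := probability_of_mass p0 p1.
have marginal (j : 'I_m) (psi : forall i, X i -> R) :
    \sum_x p x * psi j (x j) = \sum_a mass (PX j) a * psi j a.
  pose mean i := \sum_a mass (PX i) a * psi i a.
  (* Centring makes the potential zero-mean, and the factor [(i == j)%:R] confines it to coordinate
     [j]. Both signs of [s] then force equality of the means. *)
  have le0 (s : R) : \sum_x p x * (s * (psi j (x j) - mean j)) <= 0.
    apply: pH; exists (fun=> 0); first exact: cK.1.
    exists (fun i a => (i == j)%:R * (- s) * (psi i a - mean i)).
      move=> i; transitivity ((i == j)%:R * (- s) *
          (mean i - mean i * \sum_a mass (PX i) a)); last first.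
        by rewrite mass_sum; ring.
      by rewrite mulr_sumr -sumrB mulr_sumr; apply: eq_bigr => a _; ring.
    move=> x; rewrite (bigD1 j)//= eqxx big1 ?addr0.
      by rewrite mul1r; lra.
    by move=> i /negbTE ->; rewrite !mul0r.
  have sumE (s : R) : \sum_x p x * (s * (psi j (x j) - mean j)) =
      s * (\sum_x p x * psi j (x j) - mean j).
    rewrite -[mean j in RHS]mulr1 -p1 mulr_sumr -sumrB mulr_sumr.
    by apply: eq_bigr => x _; ring.
  have := le0 1; have := le0 (-1); rewrite !sumE -/(mean j); lra.
exists PXm.
  move=> j A; rewrite /pushforward !prob_mass; congr EFin.
  (* [marginal] expects a family over all coordinates. Comparing tagged letters extends the
     indicator of [A] to such a family without a cast, and it vanishes off [j]. *)
  pose psi i (a : X i) : R :=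
    (`[< exists2 b : X j, A b & Tagged X a = Tagged X b >])%:R.
  have psiE a : psi j a = (a \in A)%:R.
    congr (_%:R); congr nat_of_bool; apply/asboolP/idP.
      by move=> [b Ab /eqP]; rewrite eq_Tagged/= => /eqP ->; exact/mem_set.
    by move=> /set_mem Aa; exists a.
  under [RHS]eq_bigr do rewrite -psiE.
  rewrite -marginal; apply: eq_bigr => x _; rewrite PXmE psiE.
  by congr (_ * _%:R); congr nat_of_bool; apply/idP/idP; rewrite !inE.
move=> k Kk; under eq_bigr do rewrite PXmE.
apply: pH; exists k => //; exists (fun _ _ => 0).
  by move=> j; rewrite big1// => a _; rewrite mulr0.
by move=> x; rewrite big1 ?subr0.
Qed.

End coupling.

(** * Densities and the variational formula for the divergence *)

Section integral_lemmas.
Context d (Y : measurableType d) (R : realType).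

Lemma measurable_fun_lne (F : Y -> R) : measurable_fun [set: Y] F ->
  measurable_fun [set: Y] (fun y => lne (F y)%:E).
Proof.
move=> mF; apply: measurable_fun_if => //.
- exact: measurable_fun_ler.
- apply/measurable_EFinP; apply: measurable_funTS.
  exact: measurableT_comp.
Qed.

Lemma measurable_fun_ln (F : Y -> R) : measurable_fun [set: Y] F ->
  measurable_fun [set: Y] (fun y => (ln (F y))%:E).
Proof. by move=> mF; apply/measurable_EFinP; exact: measurableT_comp. Qed.

(* The library's integral is the difference of the integrals of the positive and
   negative parts, with [+oo - +oo = -oo], so no integrability is needed. *)
Lemma ae_le_integral (mu : {measure set Y -> \bar R}) (f g : Y -> \bar R) :
  measurable_fun [set: Y] f -> measurable_fun [set: Y] g ->
  {ae mu, forall y, f y <= g y} -> \int[mu]_y f y <= \int[mu]_y g y.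
Proof.
move=> mf mg fg; rewrite integralE [leRHS]integralE; apply: leeB.
- apply: ae_ge0_le_integral => //; [exact: measurable_funepos..|].
  apply: filterS fg => y fgy _; rewrite !funeposE ge_max !le_max lexx !orbT andbT.
  by rewrite fgy.
- apply: ae_ge0_le_integral => //; [exact: measurable_funeneg..|].
  apply: filterS fg => y fgy _; rewrite !funenegE ge_max !le_max lexx !orbT andbT.
  by rewrite leeN2 fgy.
Qed.

Lemma null_dominates_ae (mu nu : {measure set Y -> \bar R}) (A : Y -> Prop) :
  nu `<< mu -> {ae mu, forall y, A y} -> {ae nu, forall y, A y}.
Proof.
move=> /null_content_dominatesP numu [N [mN N0 AN]].
by exists N; split => //; exact: numu.
Qed.

(** Provides a real-valued, everywhere nonnegative density with a change of variables. The
    derivative used in [relent] agrees with it [Q]-almost everywhere, hence [P]-almost everywhere,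
    which gives the last clause. *)
Lemma exists_density (P Q : probability Y R) : P `<< Q ->
  exists p : Y -> R, [/\ measurable_fun [set: Y] p, forall y, (0 <= p y)%R,
    (forall f : Y -> \bar R, (forall y, 0 <= f y) -> measurable_fun [set: Y] f ->
      \int[P]_y f y = \int[Q]_y (f y * (p y)%:E)) &
    relent P Q = \int[P]_y lne (p y)%:E].
Proof.
move=> PQ; set q := Radon_Nikodym_SigmaFinite.f P Q.
have qE y : (fine (q y))%:E = q y.
  by rewrite fineK// Radon_Nikodym_SigmaFinite.f_fin_num.
have mq : measurable_fun [set: Y] q.
  exact: measurable_int (Radon_Nikodym_SigmaFinite.f_integrable PQ).
have mp : measurable_fun [set: Y] (fun y => fine (q y)).
  apply/measurable_EFinP; rewrite [X in measurable_fun _ X](_ : _ = q)//.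
  exact/funext.
exists (fun y => fine (q y)); split => //.
- by move=> y; rewrite -lee_fin qE Radon_Nikodym_SigmaFinite.f_ge0.
- move=> f f0 mf; rewrite -(Radon_Nikodym_SigmaFinite.change_of_variables PQ)//.
  by apply: eq_integral => y _; rewrite qE.
- rewrite /relent asboolT//.
  set r := Radon_Nikodym (charge_of_finite_measure P) Q.
  have mr : measurable_fun [set: Y] r.
    by apply: measurable_int; exact: Radon_Nikodym_integrable.
  have rE y : r y = (fine (r y))%:E by rewrite fineK// Radon_Nikodym_fin_num.
  have qr : ae_eq P [set: Y] q r.
    apply: (null_dominates_ae_eq _ PQ) => //.
    exact: ae_eq_Radon_Nikodym_SigmaFinite.
  apply: ae_eq_integral => //.
  + under eq_fun do rewrite rE.
    apply: measurable_fun_lne; apply/measurable_EFinP.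
    rewrite [X in measurable_fun _ X](_ : _ = r)//.
    by apply/funext => y /=; rewrite -rE.
  + exact: measurable_fun_lne.
  + by apply: filterS qr => y /(_ I) qry _; rewrite qE qry.
Qed.

(** The set where [p] vanishes has [P]-measure equal to the [Q]-integral of [p] over it, which is
    zero. *)
Lemma ae_density_gt0 (P Q : probability Y R) (p : Y -> R) :
  measurable_fun [set: Y] p -> (forall y, (0 <= p y)%R) ->
  (forall f : Y -> \bar R, (forall y, 0 <= f y) -> measurable_fun [set: Y] f ->
    \int[P]_y f y = \int[Q]_y (f y * (p y)%:E)) ->
  {ae P, forall y, (0 < p y)%R}.
Proof.
move=> mp p0 pE.
have mN : measurable [set y | (p y <= 0)%R].
  rewrite -[X in measurable X]setTI.
  exact: (@measurable_fun_le _ _ _ _ p (cst 0%R)).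
exists [set y | (p y <= 0)%R]; split => //; last first.
  by move=> y /= /negP; rewrite -leNgt.
set N := [set y | _]; have -> : P N = \int[P]_y (\1_N y)%:E.
  by rewrite integral_indic// setIT.
rewrite pE//; last first.
  by apply/measurable_EFinP; exact: measurable_indic.
rewrite integral0_eq// => y _; rewrite indicE; case: (boolP (_ \in _)) => [|_].
  rewrite inE/= => py; rewrite mul1e; congr EFin; apply/eqP.
  by rewrite eq_le py p0.
by rewrite mul0e.
Qed.

End integral_lemmas.

(** * Both halves of the variational formula *)

Section variational.
Context d (Y : measurableType d) (R : realType).
Implicit Types P Q : probability Y R.

Lemma prob_integral_cst P (r : \bar R) : \int[P]_(y in [set: Y]) r = r.
Proof. by rewrite integral_cst//= (@probability_setT _ _ _ P) mule1. Qed.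

(** The test functions of the variational formula. The two-sided bounds make [ln F] bounded, hence
    integrable under every finite measure, so that its integrals are real numbers. *)
Definition admissible Q (F : Y -> R) :=
  [/\ measurable_fun [set: Y] F,
    exists2 delta : R, (0 < delta)%R &
      exists M : R, forall y, (delta <= F y <= M)%R &
    \int[Q]_y (F y)%:E <= 1].

Lemma admissible_gt0 Q F y : admissible Q F -> (0 < F y)%R.
Proof.
by move=> [_ [delta d0 [M FM]] _]; have /andP[+ _] := FM y; exact: lt_le_trans.
Qed.

Lemma bounded_integrable (mu : {measure set Y -> \bar R}) (f : Y -> R) (M : R) :
  mu setT < +oo -> measurable_fun [set: Y] f ->
  (forall y, (`|f y| <= M)%R) -> mu.-integrable [set: Y] (fun y => (f y)%:E).
Proof.
move=> muT mf fM; apply: (@le_integrable _ _ _ _ _ measurableT _ (cst M%:E)).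
- exact/measurable_EFinP.
- move=> y _; rewrite /= lee_fin; apply: le_trans (fM y) _; exact: ler_norm.
- apply/integrableP; split => //.
  by rewrite integral_cst//= lte_mul_pinfty.
Qed.

Lemma admissible_integrable_ln (mu : {measure set Y -> \bar R}) Q F :
  mu setT < +oo -> admissible Q F ->
  mu.-integrable [set: Y] (fun y => (ln (F y))%:E).
Proof.
move=> muT aF; have [mF [delta d0 [M FM]] _] := aF.
apply: (@bounded_integrable _ _ (`|ln delta| + `|ln M|)%R) => //.
  exact: measurableT_comp.
move=> y; have /andP[dF FM'] := FM y; have F0 := admissible_gt0 y aF.
have M0 : (0 < M)%R by exact: lt_le_trans FM'.
have h1 : (ln delta <= ln (F y))%R by rewrite ler_ln.
have h2 : (ln (F y) <= ln M)%R by rewrite ler_ln.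
rewrite ler_norml; apply/andP; split.
- have := ler_norm (- ln delta); have := normr_ge0 (ln M); rewrite normrN; lra.
- have := ler_norm (ln M); have := normr_ge0 (ln delta); lra.
Qed.

(** The tangent of [ln] at the convex combination [z] lies above [ln]; average it at [x] and [y]. *)
Lemma ln_concave2 (a b x y : R) : (0 <= a)%R -> (0 <= b)%R -> (a + b = 1)%R ->
  (0 < x)%R -> (0 < y)%R -> (a * ln x + b * ln y <= ln (a * x + b * y))%R.
Proof.
move=> a0 b0 ab x0 y0; set z := (a * x + b * y)%R.
have z0 : (0 < z)%R.
  have [a00|a1] := eqVneq a 0%R.
    by rewrite /z a00 mul0r add0r (_ : b = 1%R) ?mul1r//; lra.
  have {}a0 : (0 < a)%R by rewrite lt0r a1.
  by rewrite /z ltr_pwDl ?mulr_gt0// mulr_ge0// ltW.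
have h u : (0 < u)%R -> (ln u <= ln z + u / z - 1)%R.
  by move=> u0; have := ln_le_subr1 (divr_gt0 u0 z0); rewrite ln_div ?posrE//; lra.
have -> : (ln z = a * (ln z + x / z - 1) + b * (ln z + y / z - 1))%R.
  have -> : (a * (ln z + x / z - 1) + b * (ln z + y / z - 1) =
    (a + b) * ln z + z / z - (a + b))%R by rewrite /z; ring.
  by rewrite ab divff ?gt_eqF//; ring.
by apply: lerD; apply: ler_wpM2l => //; exact: h.
Qed.

(** The divergence is at most the supremum over admissible functions. The optimal test function is
    the density itself, which is floored at [delta], capped at [n.+1] and normalised. Monotone
    convergence removes the cap, and then [delta] tends to zero. *)
Lemma relent_le P Q (s : R) : P `<< Q ->
  (forall F, admissible Q F -> \int[P]_y (ln (F y))%:E <= s%:E) ->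
  relent P Q <= s%:E.
Proof.
move=> PQ sF; have [p [mp p0 pE ->]] := exists_density PQ.
have intp : \int[Q]_y (p y)%:E = 1.
  have := pE (cst 1) (fun=> lee01) (measurable_cst _).
  rewrite prob_integral_cst => ->.
  by apply: eq_integral => y _; rewrite mul1e.
(* The bound [delta <= 1] keeps the floor below every cap [n.+1]. *)
suff step (delta : R) : (0 < delta)%R -> (delta <= 1)%R ->
    \int[P]_y lne (p y)%:E <= (s + delta)%:E.
  apply/lee_addgt0Pr => e e0; have [e1|/ltW e1] := leP e 1%R.
    by rewrite -EFinD; exact: step.
  by apply: le_trans (step 1%R _ _) _ => //; rewrite -EFinD lee_fin lerD2l.
move=> d0 d1.
pose g y : R := Num.max (p y) delta.
have mg : measurable_fun [set: Y] g by exact: measurable_maxr.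
have gd y : (delta <= g y)%R by rewrite le_max lexx orbT.
have g0 y : (0 < g y)%R := lt_le_trans d0 (gd y).
pose G (n : nat) y : R := Num.min (g y) n.+1%:R.
have mG n : measurable_fun [set: Y] (G n) by exact: measurable_minr.
have Gd n y : (delta <= G n y)%R.
  by rewrite le_min gd/= (le_trans d1)// ler1n.
have G0 n y : (0 < G n y)%R := lt_le_trans d0 (Gd n y).
have d11 : (0 < 1 + delta)%R by lra.
(* Flooring adds at most [delta] to the integral of the density, whence the normalisation by
   [1 + delta]. *)
have GA n : admissible Q (fun y => (G n y / (1 + delta))%R).
  split.
  - exact: measurable_funM.
  - exists (delta / (1 + delta))%R; first exact: divr_gt0.
    exists (n.+1%:R / (1 + delta))%R => y.
    by rewrite !ler_pM2r ?invr_gt0// Gd/= /G ge_min lexx orbT.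
  - apply: (@le_trans _ _ (\int[Q]_y (((1 + delta)^-1)%:E * ((p y)%:E + delta%:E)))).
      apply: ge0_le_integral => //.
      + by move=> y _; rewrite lee_fin divr_ge0// ltW.
      + by apply/measurable_EFinP; exact: measurable_funM.
      + apply: emeasurable_funM => //; apply: emeasurable_funD => //.
        exact/measurable_EFinP.
      + move=> y _; rewrite -EFinD -EFinM lee_fin mulrC ler_pM2l ?invr_gt0//.
        rewrite /G ge_min; apply/orP; left; rewrite ge_max.
        by have := p0 y; lra.
    rewrite ge0_integralZl//; last 3 first.
    + by apply: emeasurable_funD => //; exact/measurable_EFinP.
    + by move=> y _; rewrite -EFinD lee_fin addr_ge0// ltW.
    + by rewrite lee_fin invr_ge0 ltW.
    rewrite ge0_integralD//; last 3 first.
    + by move=> y _; rewrite lee_fin.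
    + exact/measurable_EFinP.
    + by move=> y _; rewrite lee_fin ltW.
    rewrite intp prob_integral_cst -EFinD -EFinM.
    by rewrite mulVf// gt_eqF.
(* Subtracting [ln delta] makes the logarithms nonnegative, as monotone convergence requires; [c]
   accounts for this shift and for the normalisation. *)
pose c := (ln (1 + delta) - ln delta)%R.
pose h n y := (ln (G n y) - ln delta)%R.
have h0 n y : (0 <= h n y)%R by rewrite subr_ge0 ler_ln ?posrE.
have mh n : measurable_fun [set: Y] (fun y => (h n y)%:E).
  apply/measurable_EFinP; apply: measurable_funB => //.
  exact: measurableT_comp.
have inth n : \int[P]_y (h n y)%:E <= (s + c)%:E.
  have hE y : (h n y)%:E = (ln (G n y / (1 + delta)))%:E + c%:E.
    by rewrite ln_div ?posrE// -EFinD; congr EFin; rewrite /h /c; ring.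
  under eq_integral do rewrite hE.
  rewrite integralD//; last 2 first.
  - apply: admissible_integrable_ln (GA n).
    by rewrite /= (@probability_setT _ _ _ P) ltry.
  - exact: finite_measure_integrable_cst.
  by rewrite prob_integral_cst (EFinD s); apply: leeD2r; exact: sF.
pose hoo y := (ln (g y) - ln delta)%R.
have hoo0 y : (0 <= hoo y)%R by rewrite subr_ge0 ler_ln ?posrE.
have mhoo : measurable_fun [set: Y] (fun y => (hoo y)%:E).
  apply/measurable_EFinP; apply: measurable_funB => //.
  exact: measurableT_comp.
have inthoo : \int[P]_y (hoo y)%:E <= (s + c)%:E.
  have homo y : {homo (fun n => (h n y)%:E) : k n / (k <= n)%N >-> k <= n}.
    move=> k n kn; rewrite lee_fin lerD2r ler_ln ?posrE//.
    rewrite /G le_min !ge_min lexx /=; apply/orP; right.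
    by rewrite ler_nat.
  have := cvg_monotone_convergence measurableT mh
    (fun n y _ => h0 n y : 0 <= (h n y)%:E) (fun y _ => homo y) (mu := P).
  rewrite (eq_integral (fun y => (hoo y)%:E)); last first.
    (* The sequence is eventually constant: the cap is inactive once [n] reaches [g y]. *)
    move=> y _; apply/cvg_lim => //; apply: cvg_near_cst.
    near=> n; rewrite /hoo /h; congr (ln _ - _)%:E; apply/min_idPl.
    have : (g y <= n%:R)%R by near: n; exact: nbhs_infty_ger.
    by move/le_trans; apply; rewrite ler_nat.
  move=> cvh; rewrite -(cvg_lim _ cvh)//; apply: lime_le.
    by apply/cvg_ex; eexists; exact: cvh.
  by apply: nearW => n; exact: inth.
have ihoo : P.-integrable [set: Y] (fun y => (hoo y)%:E).
  apply/integrableP; split => //.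
  under eq_integral do rewrite gee0_abs ?lee_fin//.
  by apply: le_lt_trans inthoo _; rewrite ltry.
apply: (@le_trans _ _ (\int[P]_y (ln (g y))%:E)).
  apply: ae_le_integral.
  - exact: measurable_fun_lne.
  - exact: measurable_fun_ln.
  - apply: filterS (ae_density_gt0 mp p0 pE) => y py.
    by rewrite lne_EFin// lee_fin ler_ln ?posrE// le_max lexx.
have gE y : (ln (g y))%:E = (hoo y)%:E + (ln delta)%:E.
  by rewrite -EFinD subrK.
under eq_integral do rewrite gE.
rewrite integralD//; last exact: finite_measure_integrable_cst.
rewrite prob_integral_cst.
apply: (@le_trans _ _ ((s + c)%:E + (ln delta)%:E)); first exact: leeD2r.
(* [s + c + ln delta] is [s + ln (1 + delta)], at most [s + delta]. *)
rewrite -EFinD lee_fin /c; have := ln_le_subr1 d11; lra.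
Unshelve. all: by end_near.
Qed.

(** The other half of the formula. [ln F] may fail to be integrable under [P], so the bound is
    stated for an integrable majorant [G], whose integral can later be split over the kernel. It
    comes from [ln t <= t - 1] at [t = F / (p Z)]. *)
Lemma relent_ge P Q (F : Y -> R) (Z : R) : relent P Q < +oo ->
  measurable_fun [set: Y] F -> (forall y, (0 <= F y)%R) ->
  (0 < Z)%R -> \int[Q]_y (F y)%:E <= Z%:E ->
  exists G : Y -> R, [/\ P.-integrable [set: Y] (fun y => (G y)%:E),
    {ae P, forall y, lne (F y)%:E <= (G y)%:E} &
    \int[P]_y (G y)%:E <= relent P Q + (ln Z)%:E].
Proof.
move=> fin mF F0 Z0 FZ.
have PQ : P `<< Q.
  by move: fin; rewrite /relent; case: asboolP => // _; rewrite ltxx.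
have [p [mp p0 pE DE]] := exists_density PQ.
have aep := ae_density_gt0 mp p0 pE.
have mlnp := measurable_fun_ln mp.
have lnpE : relent P Q = \int[P]_y (ln (p y))%:E.
  rewrite DE; apply: ae_eq_integral => //; first exact: measurable_fun_lne.
  by apply: filterS aep => y py _; rewrite lne_EFin.
(* Under [Q] the integrand becomes [p] times the negative part of [ln p], at most 1 because
   [ln (1 / p) <= 1 / p - 1]. *)
have neg : \int[P]_y ((fun y => (ln (p y))%:E)^\- y) < +oo.
  apply: (@le_lt_trans _ _ 1); last exact: ltry.
  rewrite pE//; last exact: measurable_funeneg.
  apply: (@le_trans _ _ (\int[Q]_y (cst 1 y))); last first.
    by rewrite prob_integral_cst.
  apply: ge0_le_integral => //.
  - by move=> y _; rewrite mule_ge0// lee_fin.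
  - apply: emeasurable_funM; [exact: measurable_funeneg|exact/measurable_EFinP].
  - move=> y _; have := p0 y; rewrite le_eqVlt => /predU1P[<-|py].
      by rewrite mule0 lee01.
    rewrite funenegE -EFinN -EFin_max -EFinM lee_fin.
    have := ln_le_subr1 (_ : 0 < (p y)^-1)%R; rewrite invr_gt0 lnV ?posrE//.
    move=> /(_ py) h; rewrite maxr_pMl; last exact: ltW.
    rewrite mul0r ge_max ler01 andbT.
    have := ler_wpM2r (ltW py) h; rewrite mulrBl mulVf ?gt_eqF//; lra.
have ilnp : P.-integrable [set: Y] (fun y => (ln (p y))%:E).
  apply/integrableP; split => //.
  under eq_integral do rewrite -[`|_|]/((abse \o (fun y => (ln (p y))%:E)) _) fune_abse.
  rewrite ge0_integralD//; [|exact: measurable_funepos|exact: measurable_funeneg].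
  (* With a finite negative part, an infinite positive part would make the divergence infinite. *)
  apply: lte_add_pinfty => //; rewrite ltey; apply/eqP => pos.
  move: fin; rewrite lnpE integralE pos addye ?ltxx//.
  by rewrite eqe_oppLR/= lt_eqF.
(* [expR (- ln (p y))] is the measurable form of [(p y)^-1]. *)
pose ratio y := (F y * expR (- ln (p y)) / Z)%R.
have ratioE y : (0 < p y)%R -> ratio y = (F y / (p y * Z))%R.
  by move=> py; rewrite /ratio expRN lnK ?posrE// invfM mulrA.
have mratio : measurable_fun [set: Y] (fun y => (ratio y)%:E).
  apply/measurable_EFinP; apply: measurable_funM => //.
  apply: measurable_funM => //; apply: measurableT_comp => //.
  apply: measurableT_comp => //; exact/measurable_EFinP.
have ratio0 y : 0 <= (ratio y)%:E.
  by rewrite lee_fin divr_ge0 ?mulr_ge0 ?expR_ge0// ltW.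
have ratio1 : \int[P]_y (ratio y)%:E <= 1.
  rewrite pE//; apply: (@le_trans _ _ (\int[Q]_y ((Z^-1)%:E * (F y)%:E))).
    apply: ge0_le_integral => //.
    - by move=> y _; rewrite mule_ge0// lee_fin.
    - by apply: emeasurable_funM => //; exact/measurable_EFinP.
    - by apply: emeasurable_funM => //; exact/measurable_EFinP.
    - move=> y _; have := p0 y; rewrite le_eqVlt => /predU1P[<-|py].
        by rewrite mule0 mule_ge0// lee_fin// invr_ge0 ltW.
      rewrite -!EFinM lee_fin ratioE// le_eqVlt; apply/orP; left; apply/eqP; field.
      by rewrite !gt_eqF.
  rewrite ge0_integralZl//; last 3 first.
  - exact/measurable_EFinP.
  - by move=> y _; rewrite lee_fin.
  - by rewrite lee_fin invr_ge0 ltW.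
  apply: (@le_trans _ _ ((Z^-1)%:E * Z%:E)).
    by apply: lee_wpmul2l => //; rewrite lee_fin invr_ge0 ltW.
  by rewrite -EFinM mulVf// gt_eqF.
have iratio : P.-integrable [set: Y] (fun y => (ratio y)%:E).
  apply/integrableP; split => //.
  under eq_integral do rewrite gee0_abs//.
  by apply: le_lt_trans ratio1 _; rewrite ltry.
(* The [-1] comes from [ln t <= t - 1] and offsets the integral of [ratio], which is at most 1. *)
pose c := (ln Z - 1)%R.
have ic : P.-integrable [set: Y] (fun y => c%:E).
  exact: finite_measure_integrable_cst.
exists (fun y => ln (p y) + ratio y + c)%R; split.
- under eq_fun do rewrite !EFinD.
  by apply: integrableD => //; exact: integrableD.
- apply: filterS aep => y py; have [F00|F1] := eqVneq (F y) 0%R.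
    by rewrite F00 le0_lneNy// leNye.
  have {}F1 : (0 < F y)%R by rewrite lt0r F1 F0.
  rewrite lne_EFin// lee_fin ratioE//.
  have := ln_le_subr1 (divr_gt0 F1 (mulr_gt0 py Z0)).
  by rewrite ln_div ?posrE ?mulr_gt0// lnM ?posrE// /c; lra.
- under eq_integral do rewrite !EFinD.
  rewrite integralD//; last exact: integrableD.
  rewrite integralD// -lnpE prob_integral_cst -addeA; apply: leeD2l.
  apply: (@le_trans _ _ (1 + c%:E)); first exact: leeD2r.
  by rewrite -EFinD lee_fin /c; lra.
Qed.

End variational.

(** * Output distributions *)

Section output_distribution_mixture.
Context d (Y : measurableType d) (R : realType) (T : finPointedType).
Variables (Q : R.-pker (discr T) ~> Y) (P : probability (discr T) R).

Lemma outdist_mass (B : set Y) :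
  outdist Q P B = \sum_(x : T) (mass P x)%:E * Q x B.
Proof. by apply: eq_bigr => x _; rewrite muleC massE. Qed.

Lemma integral_outdist (f : Y -> \bar R) : (outdist Q P).-integrable [set: Y] f ->
  \int[outdist Q P]_y f y = \sum_(x : T) (mass P x)%:E * \int[Q x]_y f y.
Proof.
move=> fi; apply: (integral_mixture (w := mass P) (k := fun x : T => Q x)) => //.
- exact: mass_ge0.
- by move=> B _; exact: outdist_mass.
Qed.

Lemma outdist_eq0 (B : set Y) x : outdist Q P B = 0 ->
  mass P x = 0%R \/ Q x B = 0.
Proof.
move=> B0; have : (mass P x)%:E * Q x B <= 0.
  rewrite -B0 outdist_mass (bigD1 x)//= leeDl// sume_ge0// => y _.
  by rewrite mule_ge0// lee_fin mass_ge0.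
rewrite le_eqVlt ltNge mule_ge0 ?lee_fin ?mass_ge0//= orbF mule_eq0 eqe.
by move=> /orP[] /eqP; [left|right].
Qed.

Lemma kernel_null_dominates x : (0 < mass P x)%R -> Q x `<< outdist Q P.
Proof.
move=> px; apply/null_content_dominatesP => B mB /outdist_eq0-/(_ x)[p0|//].
by rewrite p0 ltxx in px.
Qed.

End output_distribution_mixture.

Lemma outdist_null_dominates d (Y : measurableType d) (R : realType)
    (T : finPointedType) (Q : R.-pker (discr T) ~> Y)
    (P P' : probability (discr T) R) :
  (forall x, mass P' x = 0%R -> mass P x = 0%R) ->
  outdist Q P `<< outdist Q P'.
Proof.
move=> P'P; apply/null_content_dominatesP => B mB B0.
rewrite /= outdist_mass big1// => x _.
by have [/P'P ->|->] := outdist_eq0 x B0; rewrite ?mul0e ?mule0.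
Qed.

Section finite_expectation.
Local Open Scope ring_scope.
Context (R : realType) (T : finPointedType).
Implicit Types P : probability (discr T) R.

Lemma mass_expectation_gt0 P (g : T -> R) : (forall x, 0 < g x) ->
  0 < \sum_x mass P x * g x.
Proof.
move=> g0; have [eps eps0 epsg] := finite_positive_bound g0.
apply: (lt_le_trans eps0); rewrite -[leLHS]mulr1 -(mass_sum P) mulr_sumr.
by apply: ler_sum => x _; rewrite mulrC ler_wpM2l// mass_ge0.
Qed.

Lemma mass_expectation0 P (g : T -> R) : \sum_x mass P x * g x = 0 ->
  exists x, 0 <= g x.
Proof.
move=> g0; apply: contrapT => /forallNP neg.
have := @mass_expectation_gt0 P (fun x => - g x).
under eq_bigr do rewrite mulrN.
rewrite sumrN g0 oppr0 ltxx => /(_ _)/notF; apply => x.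
by rewrite oppr_gt0 ltNge; exact/negP.
Qed.

Lemma expR_prod_powR (I : finType) (d : R) (u c : I -> R) :
  (forall i, 0 < u i) ->
  expR d * \prod_i u i `^ c i = expR (d + \sum_i c i * ln (u i)).
Proof.
move=> u0; rewrite expRD expR_sum; congr (_ * _).
by apply: eq_bigr => i _; rewrite /powR gt_eqF.
Qed.

End finite_expectation.

(** * Convexity of the set of test functions *)

Section admissible_convexity.
Context d (Y : measurableType d) (R : realType) (Q : probability Y R).

Lemma admissible1 : admissible Q (fun=> 1%R).
Proof.
split; first exact: measurable_cst.
- by exists 1%R => //; exists 1%R => y; rewrite lexx.
- by rewrite (prob_integral_cst Q 1%:E).
Qed.

Lemma admissible_convex (F G : Y -> R) (a b : R) : (0 <= a)%R -> (0 <= b)%R ->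
  (a + b = 1)%R -> admissible Q F -> admissible Q G ->
  admissible Q (fun y => a * F y + b * G y)%R.
Proof.
move=> a0 b0 ab aF aG.
have F0 y : (0 < F y)%R by exact: admissible_gt0 aF.
have G0 y : (0 < G y)%R by exact: admissible_gt0 aG.
have [mF [dF dF0 [MF bF]] iF] := aF; have [mG [dG dG0 [MG bG]] iG] := aG.
split.
- by apply: measurable_funD; exact: measurable_funM.
- exists (a * dF + b * dG)%R.
    have [a00|a1] := eqVneq a 0%R.
      by rewrite a00 mul0r add0r (_ : b = 1%R) ?mul1r//; lra.
    have {}a0 : (0 < a)%R by rewrite lt0r a1.
    by rewrite ltr_pwDl ?mulr_gt0// mulr_ge0// ltW.
  exists (a * MF + b * MG)%R => y.
  by have /andP[? ?] := bF y; have /andP[? ?] := bG y; rewrite !lerD// ler_wpM2l.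
- under eq_integral do rewrite EFinD !EFinM.
  rewrite ge0_integralD//; last 4 first.
  + by move=> y _; rewrite mule_ge0// lee_fin// ltW.
  + by apply: emeasurable_funM => //; exact/measurable_EFinP.
  + by move=> y _; rewrite mule_ge0// lee_fin// ltW.
  + by apply: emeasurable_funM => //; exact/measurable_EFinP.
  rewrite !ge0_integralZl//; last 4 first.
  + exact/measurable_EFinP.
  + by move=> y _; rewrite lee_fin ltW.
  + exact/measurable_EFinP.
  + by move=> y _; rewrite lee_fin ltW.
  apply: (@le_trans _ _ (a%:E * 1 + b%:E * 1)).
    by apply: leeD; apply: lee_wpmul2l; rewrite ?lee_fin.
  by rewrite !mule1 -EFinD ab.
Qed.

End admissible_convexity.

(** * The two implications *)

Section forward_reverse.
Context (R : realType) (m : nat) (X : 'I_m -> finPointedType)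
  (dY : measure_display) (Y : measurableType dY)
  (QYX : R.-pker (discr {dffun forall j, X j}) ~> Y)
  (QX : forall j, probability (discr (X j)) R) (c : 'I_m -> R)
  (c_gt0 : forall j, (0 < c j)%R) (RY : probability Y R) (d : R).

Definition functional_inequality :=
  forall f : forall j, discr (X j) -> R,
     (forall j x, (0 <= f j x)%R) ->
   forall F : Y -> R,
     (forall y, (0 <= F y)%R) -> measurable_fun setT F ->
     {ae prodP QX, forall x : discr {dffun forall j, X j},
        has_integral (QYX x) (fun y => lne (F y)%:E) /\
        \sum_(j < m) (c j)%:E * lne (f j (x j))%:E <=
          \int[QYX x]_y lne (F y)%:E} ->
     (expR d * \prod_(j < m) (\int[QX j]_x f j x) `^ c j)%R%:E <=
       \int[RY]_y (F y)%:E.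

(** Each coordinate has a letter where its zero-mean potential is nonnegative; these letters form
    the word. *)
Lemma zero_mean_sum_ge0 (PX : forall j, probability (discr (X j)) R)
    (phi : forall j, X j -> R) :
  (forall j, \sum_a mass (PX j) a * phi j a = 0)%R ->
  exists x : {dffun forall j, X j}, (0 <= \sum_(j < m) phi j (x j))%R.
Proof.
move=> phi0; pose a j := sval (cid (mass_expectation0 (phi0 j))).
exists [ffun j => a j]; apply: sumr_ge0 => j _.
by rewrite ffunE; exact: svalP (cid (mass_expectation0 (phi0 j))).
Qed.

Lemma Rintegral_discr j (f : X j -> R) :
  (\int[QX j]_x f x = \sum_a mass (QX j) a * f a)%R.
Proof. by rewrite /Rintegral integral_discr. Qed.

Let logF (F : Y -> R) (x : {dffun forall j, X j}) : R :=
  fine (\int[QYX x]_y (ln (F y))%:E).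

Let kernel_fin x : QYX x setT < +oo.
Proof. by rewrite prob_kernel ltry. Qed.

Let logFE F x : admissible RY F -> (logF F x)%:E = \int[QYX x]_y (ln (F y))%:E.
Proof.
move=> aF; rewrite fineK//; apply: integrable_fin_num => //.
exact: admissible_integrable_ln aF.
Qed.

Let kernel_integral_cst x (r : R) : \int[QYX x]_(y in [set: Y]) r%:E = r%:E.
Proof. by rewrite integral_cst//= prob_kernel mule1. Qed.

Let kernel_integrable_cst x (r : R) :
  (QYX x).-integrable [set: Y] (fun=> r%:E).
Proof. exact: (@bounded_integrable _ _ _ _ _ `|r|%R). Qed.

Let logF_concave F G (a b : R) x : (0 <= a)%R -> (0 <= b)%R -> (a + b = 1)%R ->
  admissible RY F -> admissible RY G ->
  (a * logF F x + b * logF G x <= logF (fun y => a * F y + b * G y) x)%R.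
Proof.
move=> a0 b0 ab aF aG; have aH := admissible_convex a0 b0 ab aF aG.
have iF := admissible_integrable_ln (kernel_fin x) aF.
have iG := admissible_integrable_ln (kernel_fin x) aG.
rewrite -lee_fin EFinD !EFinM !logFE// -!integralZl// -integralD//; last 2 first.
- exact: integrableZl.
- exact: integrableZl.
apply: le_integral => //.
- by apply: integrableD => //; exact: integrableZl.
- exact: admissible_integrable_ln aH.
- move=> y _; rewrite -!EFinM -EFinD lee_fin.
  by apply: ln_concave2 => //; [exact: admissible_gt0 aF|exact: admissible_gt0 aG].
Qed.

(* Test functions: [f j = expR (phi j / c j)] and [expR (- s - eps) * F]. *)
Lemma functional_inequality_potentials (PX : forall j, probability (discr (X j)) R)
    (phi : forall j, X j -> R) (F : Y -> R) (s : R) :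
  functional_inequality -> (forall j, PX j `<< QX j) ->
  (forall j, \sum_a mass (PX j) a * phi j a = 0)%R -> admissible RY F ->
  s = (\sum_(j < m) c j * (\sum_a mass (PX j) a *
         ln (mass (PX j) a / mass (QX j) a)) - d)%R ->
  exists x, (logF F x - s <= \sum_(j < m) phi j (x j))%R.
Proof.
move=> fi PQ phi0 aF sE; apply: contrapT => /forallNP neg.
have gap (x : {dffun forall j, X j}) :
    (0 < logF F x - s - \sum_(j < m) phi j (x j))%R.
  by rewrite subr_gt0 ltNge; exact/negP/neg.
(* The alphabet is finite, so the strict gap is uniform. Scaling [F] by [expR (- s - eps)] preserves
   the hypothesis of the functional inequality and makes its conclusion fail by a factor
   [expR (- eps)]. *)
have [eps eps0 epsP] := finite_positive_bound gap.
have F0 y : (0 < F y)%R by exact: admissible_gt0 aF.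
have [mF _ F1] := aF.
pose u := (expR (- s - eps))%R.
have u0 : (0 < u)%R := expR_gt0 _.
pose f j (a : discr (X j)) : R := expR (phi j a / c j).
have f0 j a : (0 <= f j a)%R by rewrite expR_ge0.
have uF0 y : (0 < u * F y)%R by rewrite mulr_gt0.
have lnuF y : lne (u * F y)%:E = (ln (F y))%:E + (- s - eps)%:E.
  by rewrite lne_EFin// lnM ?posrE// expRK -EFinD addrC.
have iuF x : (QYX x).-integrable [set: Y] (fun y => lne (u * F y)%:E).
  rewrite (funext lnuF).
  by apply: integrableD => //; exact: admissible_integrable_ln aF.
have muF : measurable_fun [set: Y] (fun y => u * F y)%R.
  exact: measurable_funM.
have aeuF : {ae prodP QX, forall x : discr {dffun forall j, X j},
    has_integral (QYX x) (fun y => lne (u * F y)%:E) /\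
    \sum_(j < m) (c j)%:E * lne (f j (x j))%:E <=
      \int[QYX x]_y lne (u * F y)%:E}.
  apply: nearW => x; split; first by left; exact: integral_funepos_lt_pinfty.
  rewrite (eq_integral _ _ (fun y _ => lnuF y)).
  rewrite integralD//; last exact: admissible_integrable_ln aF.
  rewrite kernel_integral_cst -logFE// -EFinD.
  under eq_bigr do rewrite lne_EFin ?expR_gt0// expRK -EFinM.
  rewrite sumEFin lee_fin.
  under eq_bigr do rewrite mulrC divfK ?gt_eqF//.
  by have := epsP x; lra.
have := fi f f0 _ (fun y => ltW (uF0 y)) muF aeuF.
apply/negP; rewrite -ltNge.
apply: (@le_lt_trans _ _ u%:E).
  under eq_integral do rewrite EFinM.
  rewrite ge0_integralZl//; last 3 first.
  - exact/measurable_EFinP.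
  - by move=> y _; rewrite lee_fin ltW.
  - by rewrite lee_fin ltW.
  by rewrite -[leRHS]mule1; apply: lee_wpmul2l => //; rewrite lee_fin ltW.
rewrite lte_fin; under eq_bigr do rewrite Rintegral_discr.
rewrite expR_prod_powR; last first.
  by move=> j; apply: mass_expectation_gt0 => a; exact: expR_gt0.
rewrite ltr_expR.
(* By Gibbs' inequality with a zero-mean potential, each logarithm is at least minus the divergence
   of [PX j] from [QX j]. *)
suff : (- (s + d) <= \sum_(j < m) c j *
    ln (\sum_a mass (QX j) a * f j a))%R by lra.
rewrite sE subrK -sumrN; apply: ler_sum => j _.
rewrite -mulrN ler_pM2l//.
have := gibbs (fun a => phi j a / c j)%R (mass_ge0 (PX j)) (mass_sum (PX j))
  (mass_ge0 (QX j)) (fun a => @null_dominates_mass _ _ _ _ a (PQ j)).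
under [X in (X - _)%R]eq_bigr do rewrite mulrA.
by rewrite -mulr_suml phi0 mul0r sub0r.
Qed.

(** Ensures that a single infinite divergence makes the weighted sum [+oo]. *)
Lemma relent_discr_neqNy j (P : probability (discr (X j)) R) :
  relent P (QX j) != -oo.
Proof.
have [PQ|nPQ] := pselect (P `<< QX j); first by rewrite relent_discr.
by rewrite /relent asboolF.
Qed.

Lemma coupling_of_functional_inequality :
  outdist QYX (prodP QX) `<< RY -> functional_inequality ->
  forall PX : forall j, probability (discr (X j)) R,
   exists2 PXm : probability (discr {dffun forall j, X j}) R,
     is_coupling PX PXm &
     relent (outdist QYX PXm) RY + d%:E <=
       \sum_(j < m) (c j)%:E * relent (PX j) (QX j).
Proof.
move=> QY_RY fi PX.
have [PQ|/existsNP[j nPQ]] := pselect (forall j, PX j `<< QX j); last first.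
  have -> : \sum_(j < m) (c j)%:E * relent (PX j) (QX j) = +oo.
    apply/eqP; rewrite esum_eqy; last first.
      move=> i _; have := relent_discr_neqNy (PX i); case: relent => [r| |]//= _.
      by rewrite gt0_muley// lte_fin.
    by apply/existsP; exists j; rewrite /= /relent asboolF// gt0_muley ?lte_fin.
  (* The right-hand side is infinite, so any coupling will do; nonpositive functions constrain
     nothing beyond the marginals. *)
  pose K := [set k : {dffun forall j, X j} -> R | forall x, (k x <= 0)%R].
  have [||PXm cP _] := @exists_coupling _ _ _ PX K.
  - split=> // g h a b a0 b0 Kg Kh x.
    by have := mulr_ge0_le0 a0 (Kg x); have := mulr_ge0_le0 b0 (Kh x); lra.
  - move=> k phi Kk phi0; have [x x0] := zero_mean_sum_ge0 phi0.
    by exists x; exact: le_trans (Kk x) x0.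
  by exists PXm => //; rewrite leey.
pose S := (\sum_(j < m) c j * (\sum_a mass (PX j) a *
         ln (mass (PX j) a / mass (QX j) a)))%R.
have -> : \sum_(j < m) (c j)%:E * relent (PX j) (QX j) = S%:E.
  by rewrite -sumEFin; apply: eq_bigr => j _; rewrite relent_discr.
pose s := (S - d)%R.
(* The divergence bound as a cone of constraints: [t] allows scaling, and concavity of [logF] in [F]
   gives closure under sums. *)
pose K := [set k : {dffun forall j, X j} -> R | exists2 t : R, (0 <= t)%R &
  exists2 F, admissible RY F & forall x, (k x <= t * (logF F x - s))%R].
have [||PXm cP PK] := @exists_coupling _ _ _ PX K.
- split.
    exists 0%R => //; exists (fun=> 1%R); first exact: admissible1.
    by move=> x; rewrite mul0r.
  move=> g h a b a0 b0 [t t0 [F aF gF]] [u u0 [G aG hG]].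
  have at0 := mulr_ge0 a0 t0; have bu0 := mulr_ge0 b0 u0.
  have gh x : (a * g x + b * h x <=
      a * t * (logF F x - s) + b * u * (logF G x - s))%R.
    by rewrite -!mulrA; apply: lerD; exact: ler_wpM2l.
  exists (a * t + b * u)%R; first exact: addr_ge0.
  have [T0|T0] := eqVneq (a * t + b * u)%R 0%R.
    exists F => // x; apply: (le_trans (gh x)); rewrite T0 mul0r.
    move/eqP: T0; rewrite paddr_eq0// => /andP[/eqP -> /eqP ->].
    by rewrite !mul0r addr0.
  have {}T0 : (0 < a * t + b * u)%R by rewrite lt0r T0 addr_ge0.
  (* Normalised weights: the sum of the two constraints is dominated by the one for the mixture of
     [F] and [G], scaled by the total weight. *)
  pose al := (a * t / (a * t + b * u))%R; pose be := (b * u / (a * t + b * u))%R.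
  have al0 : (0 <= al)%R by rewrite divr_ge0// ltW.
  have be0 : (0 <= be)%R by rewrite divr_ge0// ltW.
  have ab1 : (al + be = 1)%R by rewrite -mulrDl divff// gt_eqF.
  exists (fun y => al * F y + be * G y)%R; first exact: admissible_convex.
  move=> x; apply: (le_trans (gh x)).
  have FG := lerB (logF_concave x al0 be0 ab1 aF aG) (lexx s).
  apply: le_trans (ler_wpM2l (ltW T0) FG).
  rewrite le_eqVlt; apply/orP; left; apply/eqP; rewrite /al /be; field.
  by rewrite gt_eqF.
- move=> k phi [t t0 [F aF kF]] phi0.
  move: t0; rewrite le_eqVlt => /predU1P[t0|t0].
    have [x x0] := zero_mean_sum_ge0 phi0; exists x.
    by apply: le_trans x0; have := kF x; rewrite -t0 mul0r.
  have [|x xP] := @functional_inequality_potentials PX (fun j a => phi j a / t)%R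
      F s fi PQ _ aF erefl.
    by move=> j; under eq_bigr do rewrite mulrA; rewrite -mulr_suml phi0 mul0r.
  exists x; apply: (le_trans (kF x)).
  move: xP; rewrite -mulr_suml ler_pdivlMr// mulrC.
  exact.
exists PXm => //.
(* A letter without [QX j]-mass has no [PX j]-mass, so no word carrying it has mass under the
   coupling. Hence the output is dominated by that of the product input. *)
have PYR : outdist QYX PXm `<< RY.
  apply: null_dominates_trans QY_RY; apply: outdist_null_dominates => x.
  rewrite mass_prodP => /eqP; rewrite prodf_seq_eq0 => /hasP[j _ /= /eqP Qj0].
  apply/eqP; rewrite eq_le mass_ge0 andbT leNgt; apply/negP => px.
  have := coupling_mass_gt0 j cP px.
  by rewrite (null_dominates_mass (PQ j) Qj0) ltxx.
suff : relent (outdist QYX PXm) RY <= s%:E.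
  by move=> /(leeD2r d%:E)/le_trans; apply; rewrite -EFinD subrK.
apply: relent_le => // F aF.
have iF : (outdist QYX PXm).-integrable [set: Y] (fun y => (ln (F y))%:E).
  apply: admissible_integrable_ln aF.
  by rewrite /= (@probability_setT _ _ _ (outdist QYX PXm)) ltry.
rewrite integral_outdist//.
under eq_bigr do rewrite -logFE// -EFinM.
rewrite sumEFin lee_fin.
have /PK : K (fun x => logF F x - s)%R.
  by exists 1%R => //; exists F => // x; rewrite mul1r.
under eq_bigr do rewrite mulrBr.
by rewrite sumrB -mulr_suml mass_sum mul1r subr_le0.
Qed.

Lemma exists_tilted_probability j (f : X j -> R) : (forall a, 0 <= f a)%R ->
  (0 < \sum_a mass (QX j) a * f a)%R ->
  exists P : probability (discr (X j)) R, forall a,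
    mass P a = (mass (QX j) a * f a / \sum_b mass (QX j) b * f b)%R.
Proof.
move=> f0 I0; apply: probability_of_mass.
- by move=> a; rewrite divr_ge0 ?(ltW I0)// mulr_ge0// mass_ge0.
- by rewrite -mulr_suml divff// gt_eqF.
Qed.

Lemma functional_inequality_of_coupling :
  (forall PX : forall j, probability (discr (X j)) R,
   exists2 PXm : probability (discr {dffun forall j, X j}) R,
     is_coupling PX PXm &
     relent (outdist QYX PXm) RY + d%:E <=
       \sum_(j < m) (c j)%:E * relent (PX j) (QX j)) ->
  functional_inequality.
Proof.
move=> cpl f f0 F F0 mF aeF.
under eq_bigr do rewrite Rintegral_discr.
pose I j := (\sum_a mass (QX j) a * f j a)%R.
have I0 j : (0 <= I j)%R by apply: sumr_ge0 => a _; rewrite mulr_ge0// mass_ge0.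
(* If some [f j] has integral zero it cannot be normalised, but then the lower bound is zero because
   [c j > 0]. *)
have [/existsP[j /eqP Ij]|] := boolP [exists j, I j == 0%R].
  rewrite (bigD1 j)//= -/(I j) Ij powR0 ?gt_eqF// mul0r mulr0.
  by apply: integral_ge0 => y _; rewrite lee_fin.
rewrite negb_exists => /forallP In0.
have {In0}I0 j : (0 < I j)%R by rewrite lt0r In0 I0.
rewrite expR_prod_powR//.
pose PX j := sval (cid (exists_tilted_probability (f0 j) (I0 j))).
have PXE j a : mass (PX j) a = (mass (QX j) a * f j a / I j)%R.
  exact: (svalP (cid (exists_tilted_probability (f0 j) (I0 j)))).
have PQ j : PX j `<< QX j.
  by apply: mass_null_dominates => a Q0; rewrite PXE Q0 !mul0r.
have [PXm cP] := cpl PX.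
set D := relent _ _ => DS.
(* For the tilted marginals, [relent (PX j) (QX j)] is the [PX j]-mean of [ln (f j)] minus
   [ln (I j)]; [U] collects the means. *)
pose U := (\sum_(j < m) c j * \sum_a mass (PX j) a * ln (f j a))%R.
have SE : \sum_(j < m) (c j)%:E * relent (PX j) (QX j) =
    (U - \sum_(j < m) c j * ln (I j))%:E.
  rewrite -sumrB -sumEFin; apply: eq_bigr => j _.
  rewrite relent_discr// -EFinM -mulrBr; congr (_ * _)%:E.
  rewrite -[ln (I j)]mul1r -(mass_sum (PX j)) mulr_suml -sumrB.
  apply: eq_bigr => a _; have [->|pa] := eqVneq (mass (PX j) a) 0%R.
    by rewrite !mul0r subr0.
  have qa : mass (QX j) a != 0%R.
    by apply: contra_neq pa => q0; rewrite PXE q0 !mul0r.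
  have fa : (0 < f j a)%R.
    rewrite lt0r f0 andbT; apply: contra_neq pa => fa0.
    by rewrite PXE fa0 mulr0 mul0r.
  rewrite -mulrBr -ln_div ?posrE//.
  by congr (_ * ln _)%R; rewrite PXE; field; rewrite qa gt_eqF.
rewrite SE in DS.
have mlF := measurable_fun_lne mF.
pose A (x : {dffun forall j, X j}) := (\sum_(j < m) c j * ln (f j (x j)))%R.
(* A word charged by the coupling has positive product mass, so the almost-everywhere hypothesis
   holds at it. *)
have AF (x : {dffun forall j, X j}) : (0 < mass PXm x)%R ->
    (A x)%:E <= \int[QYX x]_y lne (F y)%:E.
  move=> px.
  have pj j : (0 < mass (QX j) (x j))%R /\ (0 < f j (x j))%R.
    have := coupling_mass_gt0 j cP px; rewrite PXE => h.
    rewrite !lt0r mass_ge0 f0 !andbT; split; apply: contraTneq h => ->.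
      by rewrite !mul0r ltxx.
    by rewrite mulr0 mul0r ltxx.
  have qx : (0 < mass (prodP QX) x)%R.
    by rewrite mass_prodP; apply: prodr_gt0 => j _; have [] := pj j.
  have [_] := ae_discrP aeF qx; apply: le_trans.
  rewrite /A -sumEFin le_eqVlt; apply/orP; left; apply/eqP.
  by apply: eq_bigr => j _; rewrite lne_EFin ?EFinM//; have [] := pj j.
have UE : (\sum_x mass PXm x * A x = U)%R.
  rewrite /A; under eq_bigr do rewrite mulr_sumr.
  rewrite exchange_big/=; apply: eq_bigr => j _.
  rewrite -(coupling_expectation (fun a => ln (f j a)) cP) mulr_sumr.
  by apply: eq_bigr => x _; rewrite mulrCA.
have Dfin : D < +oo by rewrite ltey; apply: contraTneq DS => ->.
have IF0 : 0 <= \int[RY]_y (F y)%:E by apply: integral_ge0 => y _; rewrite lee_fin.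
(* Adding [e] gives [Z] a logarithm even if the integral of [F] is zero. *)
apply/lee_addgt0Pr => e e0.
have [FZ|] := leP +oo (\int[RY]_y (F y)%:E).
  by apply: (@le_trans _ _ +oo); rewrite ?leey// (le_trans FZ)// leeDl// lee_fin ltW.
move=> Foo; have Ffin : \int[RY]_y (F y)%:E \is a fin_num by rewrite ge0_fin_numE.
rewrite -(fineK Ffin) -EFinD lee_fin; set Z := (_ + e)%R.
have Z0 : (0 < Z)%R by rewrite /Z ltr_wpDl// fine_ge0.
have FZ : \int[RY]_y (F y)%:E <= Z%:E.
  by rewrite -(fineK Ffin) lee_fin lerDl ltW.
have [G [iG FG GD]] := relent_ge Dfin mF F0 Z0 FZ.
have UD : U%:E <= D + (ln Z)%:E.
  apply: le_trans GD; rewrite integral_outdist// -UE -sumEFin.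
  apply: lee_sum => x _; have := mass_ge0 PXm x; rewrite le_eqVlt => /predU1P[<-|px].
    by rewrite mul0r mul0e.
  rewrite EFinM lee_pmul2l// ?lte_fin//.
  apply: le_trans (AF x px) _; apply: ae_le_integral => //.
    exact: measurable_int iG.
  by apply: (null_dominates_ae _ FG); exact: kernel_null_dominates.
rewrite -[Z in leRHS]lnK ?posrE// ler_expR.
(* [DS] excludes [D = +oo] and [UD] excludes [D = -oo]; otherwise [D] and [U] cancel between the two
   inequalities. *)
move: DS UD; case: (D) => [r| |] //; rewrite -!EFinD !lee_fin; lra.
Qed.

End forward_reverse.

Theorem theorem6 (R : realType) (m : nat) (m_gt0 : (0 < m)%N)
    (X : 'I_m -> finPointedType)
    (dY : measure_display) (Y : measurableType dY)
    (QYX : R.-pker (discr {dffun forall j, X j}) ~> Y)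
    (QX : forall j, probability (discr (X j)) R)
    (c : 'I_m -> R) (c_gt0 : forall j, (0 < c j)%R)
    (RY : probability Y R) (d : R)
    (QY_RY : outdist QYX (prodP QX) `<< RY) :
  (forall f : forall j, discr (X j) -> R,
     (forall j x, (0 <= f j x)%R) ->
   forall F : Y -> R,
     (forall y, (0 <= F y)%R) -> measurable_fun setT F ->
     {ae prodP QX, forall x : discr {dffun forall j, X j},
        has_integral (QYX x) (fun y => lne (F y)%:E) /\
        \sum_(j < m) (c j)%:E * lne (f j (x j))%:E <=
          \int[QYX x]_y lne (F y)%:E} ->
     (expR d * \prod_(j < m) (\int[QX j]_x f j x) `^ c j)%R%:E <=
       \int[RY]_y (F y)%:E)
  <->
  (forall PX : forall j, probability (discr (X j)) R,
   exists2 PXm : probability (discr {dffun forall j, X j}) R,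
     is_coupling PX PXm &
     relent (outdist QYX PXm) RY + d%:E <=
       \sum_(j < m) (c j)%:E * relent (PX j) (QX j)).
Proof.
split; last exact: functional_inequality_of_coupling.
by move=> fi; exact: coupling_of_functional_inequality.
Qed.
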